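(* For each $q$ there is a constant $C(q)$ depending only on $q$ such that the following holds. Let $X,Y$ be real $m\times n$ matrices with $\|X\|_\infty\le1$, $\|Y\|_\infty\le1$, $\|X\|_*\le q\sqrt{mn}$ and $\|Y\|_*\le q\sqrt{mn}$. Let $P,Q$ be $m\times n$ matrices such that $P$ is binary and all entries of $Q$ lie in $[0,1]$. Then $$\|(X-Y)\circ Q\|_{\bar F}\le\|(X-Y)\circ P\|_{\bar F}+C(q)\sqrt{\frac{\log(-\log\|P-Q\|_\Box)}{-\log\|P-Q\|_\Box}}.$$
   Context: A binary matrix has entries in $\{0,1\}$. $\circ$ is the entrywise product; $\|A\|_\infty=\max|a_{ij}|$; $\|A\|_*$ is the sum of singular values; $\|A\|_{\bar F}=\big(\frac1{mn}\sum_{i,j}a_{ij}^2\big)^{1/2}$; $\|A\|_\Box=\frac1{mn}\max\{|x^TAy|:x\in\mathbb{R}^m,y\in\mathbb{R}^n,\|x\|_\infty\le1,\|y\|_\infty\le1\}$.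
   Formalization: The formal theorem assumes ‖P−Q‖_□ ≤ e^{−e}, since the claim fails as the cut norm nears 1/e (P=0, Q=cJ, X=J, Y=−J) and its error term is undefined above 1/e; at ‖P−Q‖_□=0 the error term is read as 0. *)

(* Defs.v *)
From HB Require Import structures.
From mathcomp Require Import all_boot all_order all_algebra.
From mathcomp Require Import boolp classical_sets reals sequences exp.
Set Implicit Arguments. Unset Strict Implicit. Unset Printing Implicit Defensive.
Import Order.TTheory GRing.Theory Num.Theory.
Local Open Scope ring_scope.
Local Open Scope classical_set_scope.

Section Defs.
Variable R : realType.

Definition binary_mx m n (A : 'M[R]_(m, n)) : Prop :=
  forall i j, A i j = 0 \/ A i j = 1.

Definition hadamard m n (A B : 'M[R]_(m, n)) : 'M[R]_(m, n) :=
  \matrix_(i, j) (A i j * B i j).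

Definition maxnorm m n (A : 'M[R]_(m, n)) : R :=
  \big[Num.max/0]_(i < m) \big[Num.max/0]_(j < n) `|A i j|.

(* s is the list of singular values of A (with multiplicity, padded by zeros
   to length n): the nonnegative square roots of the eigenvalues of A^T A,
   i.e. char_poly (A^T A) = prod_(s_k in s) (X - s_k^2). *)
Definition singular_values m n (A : 'M[R]_(m, n)) (s : seq R) : Prop :=
  all (fun x => 0 <= x) s /\
  char_poly (A^T *m A) = \prod_(x <- s) ('X - (x ^+ 2)%:P).

Definition nucnorm m n (A : 'M[R]_(m, n)) : R :=
  xget (0 : R) (fun v : R => exists s, singular_values A s /\ v = \sum_(x <- s) x).

Definition nfrob m n (A : 'M[R]_(m, n)) : R :=
  Num.sqrt ((m * n)%:R^-1 * \sum_(i < m) \sum_(j < n) A i j ^+ 2).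

Definition cutnorm m n (A : 'M[R]_(m, n)) : R :=
  (m * n)%:R^-1 *
  sup [set `|(x^T *m A *m y) 0 0| | x in
        [set x : 'cV[R]_m | forall i, `|x i 0| <= 1] &
        y in [set y : 'cV[R]_n | forall j, `|y j 0| <= 1]].

(* error term sqrt( log(-log c) / (-log c) ), with its limit value 0 at c = 0 *)
Definition err_term (c : R) : R :=
  if c == 0 then 0 else Num.sqrt (ln (- ln c) / (- ln c)).

End Defs.

(* Main.v *)
(* Truncate the singular value decomposition X = sum s_i u_i v_i^T at
   s_i >= e sqrt(mn).  The discarded part has squared Frobenius norm at most
   e sqrt(mn) times the nuclear norm.  The kept singular vectors are flat: as
   X is bounded, s_i u_i = X v_i and s_i v_i = X^T u_i force entries of size
   O(1 / (e sqrt m)) and O(1 / (e sqrt n)).  (The decomposition is taken over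
   R[i]; the real part of each term is two real rank one matrices.)  Hence the
   truncation W is a combination of rank one matrices x y^T with |x|, |y| <= 1
   and total weight K = O(q / e^2), and the entrywise product with W multiplies
   the cut norm by at most K.  Applied twice, <W o W, Q - P> <= K^2 mn
   |P - Q|_cut, which compares the masks Q and P on W.  Choosing
   e = |P - Q|_cut^(1/8) gives a power of the cut norm as error, more than the
   logarithmic bound asks for. *)
Require Import Defs.
From HB Require Import structures.
From mathcomp Require Import all_boot all_order all_algebra.
From mathcomp Require Import boolp classical_sets reals sequences exp.
From mathcomp Require Import complex spectral.
From mathcomp Require Import ring lra.
Set Implicit Arguments.
Unset Strict Implicit.
Unset Printing Implicit Defensive.
Import Order.TTheory GRing.Theory Num.Theory.
Local Open Scope ring_scope.

(** * Singular value decomposition of a real matrix, over [R[i]] *)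

Section SingularValueDecomposition.
Local Open Scope sesquilinear_scope.
Local Open Scope complex_scope.

Lemma char_poly_conj (K : fieldType) n (P A : 'M[K]_n) :
  P \in unitmx -> char_poly (invmx P *m A *m P) = char_poly A.
Proof.
move=> Pu; rewrite /char_poly /char_poly_mx !map_mxM.
have VP : map_mx polyC (invmx P) *m map_mx polyC P = 1%:M.
  by rewrite -map_mxM mulVmx // map_mx1.
have -> : 'X%:M - map_mx polyC (invmx P) *m map_mx polyC A *m map_mx polyC P =
   map_mx polyC (invmx P) *m ('X%:M - map_mx polyC A) *m map_mx polyC P.
  by rewrite mulmxBr mulmxBl scalar_mxC -(mulmxA 'X%:M) VP mulmx1.
by rewrite !det_mulmx mulrAC -det_mulmx VP det1 mul1r.
Qed.

Lemma conj_real_complex (R : realType) (x : R) : Num.conj (x%:C) = x%:C.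
Proof. by apply: conj_Creal; apply/complex_realP; exists x. Qed.

Lemma sqr_norm_conj (R : realType) (z : R[i]) :
  Num.conj z * z = (complex.Re z ^+ 2 + complex.Im z ^+ 2)%:C.
Proof. by rewrite add_Re2_Im2 normCK mulrC. Qed.

(** Spectral theorem applied to [A^T *m A]. The columns of [g] are the left singular vectors scaled
    by the [s i], so zero singular values need no separate treatment; the rows of [u] are the
    conjugated right singular vectors. *)
Lemma complex_svd (R : realType) m n (A : 'M[R]_(m, n)) :
  exists (s : 'I_n -> R) (g : 'M[R[i]]_(m, n)) (u : 'M[R[i]]_n),
  [/\ (forall i, 0 <= s i) /\ nucnorm A = \sum_i s i,
      map_mx (real_complex R) A = g *m u,
      u *m u^t* = 1%:M &
      g^t* *m g = diag_mx (\row_i (s i ^+ 2)%:C)].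
Proof.
set B := map_mx _ A.
have BH : B^t* = map_mx (real_complex R) A^T.
  by apply/matrixP=> i j; rewrite !mxE conj_real_complex.
set S := B^t* *m B.
have SH : S^t* = S by rewrite /S trmx_mul map_mxM trmxCK.
have Snormal : S \is normalmx by apply/normalmxP; rewrite SH.
have /orthomx_spectralP := Snormal.
set P := spectralmx S; set d := spectral_diag S => SE.
have Pun : P \is unitarymx by exact: spectral_unitarymx.
have PP : P *m P^t* = 1%:M by apply/unitarymxP.
have PVP : P^t* *m P = 1%:M by rewrite -invmx_unitary // mulVmx // unitarymx_unit.
pose g := B *m P^t*.
have gg : g^t* *m g = diag_mx d.
  rewrite /g trmx_mul map_mxM trmxCK mulmxA -(mulmxA P) -/S SE invmx_unitary //.
  by rewrite !mulmxA PP mul1mx -mulmxA PP mulmx1.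
(* Each eigenvalue is the squared norm of a column of [g], hence real and nonnegative, which makes
   its real square root [s i] available. *)
have dE i : d 0 i = (\sum_a (complex.Re (g a i) ^+ 2 + complex.Im (g a i) ^+ 2))%:C.
  have := congr1 (fun M : 'M_n => M i i) gg; rewrite !mxE eqxx mulr1n => <-.
  rewrite rmorph_sum; apply: eq_bigr => a _.
  by rewrite !mxE sqr_norm_conj.
pose t i := \sum_a (complex.Re (g a i) ^+ 2 + complex.Im (g a i) ^+ 2).
have t_ge0 i : 0 <= t i by apply: sumr_ge0 => a _; rewrite addr_ge0 ?sqr_ge0.
pose s i := Num.sqrt (t i).
have sE i : s i ^+ 2 = t i by rewrite sqr_sqrtr.
have charS : char_poly S = \prod_(i < n) ('X - ((s i ^+ 2)%:C)%:P).
  rewrite SE char_poly_conj ?unitarymx_unit // char_poly_trig ?diag_mx_is_trig //.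
  by apply: eq_bigr => i _; rewrite !mxE eqxx mulr1n dE sE.
have SA : S = map_mx (real_complex R) (A^T *m A) by rewrite /S BH map_mxM.
have s_sv : singular_values A [seq s i | i <- enum 'I_n].
  split; first by apply/allP => _ /mapP[i _ ->]; apply: sqrtr_ge0.
  apply: (map_inj_poly (@complexI R)) => //.
  rewrite map_char_poly -SA charS big_map big_enum rmorph_prod.
  by apply: eq_bigr => i _; rewrite /= map_polyXsubC.
(* The list picked by [xget] may differ from [s], but unique factorization of the characteristic
   polynomial makes the squares agree up to permutation, and nonnegative numbers are recovered from
   their squares. *)
have nucE : nucnorm A = \sum_i s i.
  rewrite /nucnorm.
  have [|w [[w_ge0 wA] ->]] := @xgetPex _ (0 : R) (fun v : R => exists w,
      singular_values A w /\ v = \sum_(x <- w) x).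
    by exists (\sum_(x <- [seq s i | i <- enum 'I_n]) x), [seq s i | i <- enum 'I_n].
  have := s_sv.2; rewrite wA => ws.
  have /prod_XsubC_eq pw : \prod_(x <- [seq x ^+ 2 | x <- w]) ('X - x%:P) =
      \prod_(x <- [seq s i ^+ 2 | i <- enum 'I_n]) ('X - x%:P).
    by move: ws; rewrite !big_map.
  have : \sum_(x <- w) Num.sqrt (x ^+ 2) = \sum_i Num.sqrt (s i ^+ 2).
    rewrite -(big_map (fun x => x ^+ 2) xpredT Num.sqrt) (perm_big _ pw) /=.
    by rewrite big_map big_enum.
  under eq_big_seq => x xw do rewrite sqrtr_sqr ger0_norm ?(allP w_ge0) //.
  move=> ->; apply: eq_bigr => i _.
  by rewrite sqrtr_sqr ger0_norm // sqrtr_ge0.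
exists s, g, P; split => //.
- by split => // i; apply: sqrtr_ge0.
- by rewrite /g -mulmxA PVP mulmx1.
- by rewrite gg; congr diag_mx; apply/rowP => i; rewrite mxE sE dE.
Qed.
End SingularValueDecomposition.

(** * Entrywise multipliers for the cut norm *)

Section CutMultipliers.
Variables (R : realType) (m n : nat).
Implicit Types (D W V : 'M[R]_(m, n)) (K L c : R).

(** Unnormalized: [c] bounds [m * n] times the cut norm. *)
Definition cut_bound D c := forall (x : 'I_m -> R) (y : 'I_n -> R),
  (forall a, `|x a| <= 1) -> (forall b, `|y b| <= 1) ->
  `|\sum_a \sum_b x a * D a b * y b| <= c.

(** The Schur multiplier [W] has operator norm at most [K] for the cut norm. *)
Definition cut_multiplier K W :=
  forall D c, cut_bound D c -> cut_bound (hadamard W D) (K * c).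

Lemma cut_bound_ge0 D c : cut_bound D c -> 0 <= c.
Proof.
move=> /(_ (fun=> 0) (fun=> 0)) h; apply: le_trans (h _ _) => //.
  by move=> a; rewrite normr0.
by move=> b; rewrite normr0.
Qed.

Lemma cut_multiplier_le K L W :
  K <= L -> cut_multiplier K W -> cut_multiplier L W.
Proof.
move=> KL hW D c hD x y hx hy; apply: le_trans (hW _ _ hD x y hx hy) _.
by rewrite ler_wpM2r // (cut_bound_ge0 hD).
Qed.

Lemma cut_multiplier0 : cut_multiplier 0 0.
Proof.
move=> D c _ x y _ _; rewrite mul0r big1 ?normr0 // => a _.
by rewrite big1 // => b _; rewrite !mxE mul0r mulr0 mul0r.
Qed.

Lemma cut_multiplierD K L W V :
  cut_multiplier K W -> cut_multiplier L V -> cut_multiplier (K + L) (W + V).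
Proof.
move=> hW hV D c hD x y hx hy.
have -> : \sum_a \sum_b x a * hadamard (W + V) D a b * y b =
   \sum_a \sum_b x a * hadamard W D a b * y b +
   \sum_a \sum_b x a * hadamard V D a b * y b.
  rewrite -big_split; apply: eq_bigr => a _; rewrite -big_split /=.
  by apply: eq_bigr => b _; rewrite !mxE; ring.
rewrite mulrDl (le_trans (ler_normD _ _)) // lerD //; first exact: hW.
exact: hV.
Qed.

Lemma cut_multiplierN K W : cut_multiplier K W -> cut_multiplier K (- W).
Proof.
move=> hW D c hD x y hx hy.
have -> : \sum_a \sum_b x a * hadamard (- W) D a b * y b =
   - \sum_a \sum_b x a * hadamard W D a b * y b.
  rewrite -sumrN; apply: eq_bigr => a _; rewrite -sumrN.
  by apply: eq_bigr => b _; rewrite !mxE; ring.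
by rewrite normrN; apply: hW.
Qed.

Lemma cut_multiplier_sum (I : finType) (P : pred I) (K : I -> R)
    (W : I -> 'M[R]_(m, n)) :
  (forall i, P i -> cut_multiplier (K i) (W i)) ->
  cut_multiplier (\sum_(i | P i) K i) (\sum_(i | P i) W i).
Proof.
move=> h; apply: (big_ind2 cut_multiplier) => //; first exact: cut_multiplier0.
by move=> *; apply: cut_multiplierD.
Qed.

(** The factors [x / al] and [y / be] have entries in [-1, 1], so they are absorbed into the test
    vectors. *)
Lemma cut_multiplier_rank1 (al be : R) (x : 'I_m -> R) (y : 'I_n -> R) :
  0 < al -> 0 < be -> (forall a, `|x a| <= al) -> (forall b, `|y b| <= be) ->
  cut_multiplier (al * be) (\matrix_(a, b) (x a * y b)).
Proof.
move=> al0 be0 hx hy D c hD z w hz hw.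
have -> : \sum_a \sum_b z a * hadamard (\matrix_(a, b) (x a * y b)) D a b * w b =
   (al * be) * \sum_a \sum_b (z a * (x a / al)) * D a b * (w b * (y b / be)).
  rewrite mulr_sumr; apply: eq_bigr => a _; rewrite mulr_sumr.
  apply: eq_bigr => b _; rewrite !mxE; field.
  by rewrite !gt_eqF.
have unit_le (p q r : R) : 0 < r -> `|p| <= 1 -> `|q| <= r -> `|p * (q / r)| <= 1.
  move=> r0 hp hq; rewrite normrM mulr_ile1 //.
  by rewrite normrM normfV (gtr0_norm r0) ler_pdivrMr // mul1r.
have ab0 := mulr_gt0 al0 be0.
rewrite normrM (gtr0_norm ab0) ler_pM2l //.
by apply: hD => k; apply: unit_le.
Qed.

(** Multiply by [W] twice, then test against the all-ones vectors. *)
Lemma cut_multiplier_sqr K W D c : cut_multiplier K W -> cut_bound D c ->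
  `|\sum_a \sum_b W a b ^+ 2 * D a b| <= K ^+ 2 * c.
Proof.
move=> hW hD; have := hW _ _ (hW _ _ hD) (fun=> 1) (fun=> 1).
rewrite mulrA -expr2; under eq_bigr => a _ do under eq_bigr => b _ do
  rewrite !mxE mul1r mulr1 mulrA -expr2.
by apply=> ?; rewrite normr1.
Qed.
End CutMultipliers.

(** * Flatness of singular vectors and the norm of the discarded part *)

Section Truncation.
Local Open Scope sesquilinear_scope.
Local Open Scope complex_scope.

Lemma complex_Re_sum (R : rcfType) (I : Type) (r : seq I) (P : pred I)
    (F : I -> R[i]) :
  complex.Re (\sum_(i <- r | P i) F i) = \sum_(i <- r | P i) complex.Re (F i).
Proof. by apply: (big_morph (@complex.Re R)) => // -[a b] [c d]. Qed.

Lemma complex_Im_sum (R : rcfType) (I : Type) (r : seq I) (P : pred I)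
    (F : I -> R[i]) :
  complex.Im (\sum_(i <- r | P i) F i) = \sum_(i <- r | P i) complex.Im (F i).
Proof. by apply: (big_morph (@complex.Im R)) => // -[a b] [c d]. Qed.

(* AM-GM with weight [t = s / sqrt m]. *)
Lemma sum_norm_le (R : rcfType) m (x : 'I_m -> R) (s : R) :
  0 < s -> \sum_a x a ^+ 2 <= s ^+ 2 ->
  \sum_a `|x a| <= s * Num.sqrt m%:R.
Proof.
move=> s0; case: (posnP m) => [m0 _|m_gt0 hx].
  rewrite big1 ?mulr_ge0 ?sqrtr_ge0 ?ltW // => a _.
  by have := ltn_ord a; rewrite [X in (_ < X)%N]m0.
set r := Num.sqrt m%:R; have r0 : 0 < r by rewrite sqrtr_gt0 ltr0n.
have rr : r ^+ 2 = m%:R by rewrite sqr_sqrtr ?ler0n.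
have : \sum_a `|x a| <= \sum_(a < m) ((s / r + x a ^+ 2 * (r / s)) / 2).
  apply: ler_sum => a _; rewrite -real_normK ?num_real //.
  have : 0 <= (s / r - `|x a|) ^+ 2 * (r / s).
    by rewrite mulr_ge0 ?sqr_ge0 // divr_ge0 ?ltW.
  have -> : (s / r - `|x a|) ^+ 2 * (r / s) =
     s / r - 2 * `|x a| + `|x a| ^+ 2 * (r / s).
    by field; rewrite !gt_eqF.
  lra.
move=> /le_trans; apply.
rewrite -mulr_suml big_split /= sumr_const card_ord -[\sum_a _ * _]mulr_suml.
have : (\sum_a x a ^+ 2) * (r / s) <= s ^+ 2 * (r / s).
  by rewrite ler_wpM2r // divr_ge0 ?ltW.
have -> : s ^+ 2 * (r / s) = s * r by field; rewrite gt_eqF.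
have -> : s / r *+ m = s * r.
  by rewrite -mulr_natl -rr; field; rewrite gt_eqF.
lra.
Qed.

(** As [u] is unitary, each row of [g] has the same norm as the corresponding row of [A], whose
    squared norm is at most [n]. *)
Lemma complex_svd_entry_le (R : realType) m n (A : 'M[R]_(m, n))
    (g : 'M[R[i]]_(m, n)) (u : 'M[R[i]]_n) :
  (forall a b, `|A a b| <= 1) ->
  map_mx (real_complex R) A = g *m u ->
  u *m u^t* = 1%:M ->
  forall a i, `|complex.Re (g a i)| <= Num.sqrt n%:R /\
              `|complex.Im (g a i)| <= Num.sqrt n%:R.
Proof.
move=> A1 AE uu a i.
have h : \sum_i (complex.Re (g a i) ^+ 2 + complex.Im (g a i) ^+ 2) <= n%:R.
  have : g *m g^t* = map_mx (real_complex R) (A *m A^T).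
    have -> : map_mx (real_complex R) (A *m A^T) =
        map_mx (real_complex R) A *m (map_mx (real_complex R) A)^t*.
      rewrite map_mxM; congr (_ *m _).
      by apply/matrixP=> p q; rewrite !mxE conj_real_complex.
    by rewrite AE trmx_mul map_mxM mulmxA -(mulmxA g) uu mulmx1.
  move=> /matrixP/(_ a a); rewrite !mxE.
  under eq_bigr => j _ do rewrite !mxE mulrC sqr_norm_conj.
  rewrite -rmorph_sum => /complexI ->.
  have -> : n%:R = \sum_(b < n) 1 :> R by rewrite sumr_const card_ord.
  apply: ler_sum => b _; rewrite mxE -expr2 -real_normK ?num_real //.
  by rewrite expr_le1.
have {}h : complex.Re (g a i) ^+ 2 + complex.Im (g a i) ^+ 2 <= n%:R.
  apply: le_trans h; rewrite (bigD1 i) //= lerDl.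
  by apply: sumr_ge0 => j _; rewrite addr_ge0 ?sqr_ge0.
by split; rewrite -sqrtr_sqr ler_wsqrtr // (le_trans _ h) //
  ?lerDl ?lerDr ?sqr_ge0.
Qed.

(* The [i]-th right singular vector is [s_i^-2] times the image of the [i]-th
   column of [g], which has norm [s_i]; this is what makes its entries small. *)
Lemma complex_svd_vector_le (R : realType) m n (A : 'M[R]_(m, n)) (s : 'I_n -> R)
    (g : 'M[R[i]]_(m, n)) (u : 'M[R[i]]_n) :
  (forall a b, `|A a b| <= 1) ->
  map_mx (real_complex R) A = g *m u ->
  g^t* *m g = diag_mx (\row_i (s i ^+ 2)%:C) ->
  forall i b, 0 < s i ->
    `|complex.Re (u i b)| <= Num.sqrt m%:R / s i /\
    `|complex.Im (u i b)| <= Num.sqrt m%:R / s i.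
Proof.
move=> A1 AE gg i b s0.
have gi : \sum_a (complex.Re (g a i) ^+ 2 + complex.Im (g a i) ^+ 2) = s i ^+ 2.
  move/matrixP/(_ i i): gg; rewrite !mxE eqxx mulr1n.
  under eq_bigr => a _ do rewrite !mxE sqr_norm_conj.
  by rewrite -rmorph_sum => /complexI.
have uE : (s i ^+ 2)%:C * u i b = \sum_a Num.conj (g a i) * (A a b)%:C.
  have := congr1 (mulmx (g^t* )) AE; rewrite mulmxA gg => /matrixP/(_ i b).
  rewrite mul_diag_mx !mxE => <-.
  by apply: eq_bigr => a _; rewrite !mxE.
(* Serves both parts of [u i b]: [x] is the real part of the [i]-th column of [g], or minus its
   imaginary part because of the conjugation in [uE]. *)
have bound (x : 'I_m -> R) (z : R) : s i ^+ 2 * z = \sum_a x a * A a b ->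
    \sum_a x a ^+ 2 <= s i ^+ 2 -> `|z| <= Num.sqrt m%:R / s i.
  move=> zE hx; rewrite -(ler_pM2l (exprn_gt0 2 s0)).
  have -> : s i ^+ 2 * (Num.sqrt m%:R / s i) = s i * Num.sqrt m%:R.
    by field; rewrite gt_eqF.
  apply: le_trans (sum_norm_le s0 hx).
  rewrite -[s i ^+ 2 * _](ger0_norm (mulr_ge0 (sqr_ge0 _) (normr_ge0 _))).
  rewrite normrM normr_id -normrM zE (le_trans (ler_norm_sum _ _ _)) //.
  by apply: ler_sum => a _; rewrite normrM ler_piMr.
split.
- apply: (bound (fun a => complex.Re (g a i))).
    have := congr1 (@complex.Re R) uE; rewrite complex_Re_sum.
    case: (u i b) => p q /=; rewrite mul0r subr0 => ->; apply: eq_bigr => a _.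
    by case: (g a i) => x y /=; rewrite mulr0 subr0.
  by rewrite -gi; apply: ler_sum => a _; rewrite lerDl sqr_ge0.
- apply: (bound (fun a => - complex.Im (g a i))).
    have := congr1 (@complex.Im R) uE; rewrite complex_Im_sum.
    case: (u i b) => p q /=; rewrite mul0r addr0 => ->; apply: eq_bigr => a _.
    by case: (g a i) => x y /=; rewrite mulr0 add0r.
  by rewrite -gi; apply: ler_sum => a _; rewrite sqrrN lerDr sqr_ge0.
Qed.

(** With [D] the coordinate projection onto [J], the partial sum is [g *m D *m u]; cyclicity of the
    trace gives its squared Frobenius norm, which dominates that of its real part. *)
Lemma complex_svd_tail (R : realType) m n (s : 'I_n -> R)
    (g : 'M[R[i]]_(m, n)) (u : 'M[R[i]]_n) (J : pred 'I_n) :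
  u *m u^t* = 1%:M ->
  g^t* *m g = diag_mx (\row_i (s i ^+ 2)%:C) ->
  \sum_a \sum_b complex.Re (\sum_(i | J i) g a i * u i b) ^+ 2 <=
    \sum_(i | J i) s i ^+ 2.
Proof.
move=> uu gg.
pose D : 'M[R[i]]_n := diag_mx (\row_i (J i)%:R).
have DH : D^t* = D.
  apply/matrixP=> i j; rewrite !mxE rmorphMn /= rmorph_nat eq_sym.
  by case: eqVneq => [->|].
have DD : D *m D = D.
  rewrite /D mulmx_diag; congr diag_mx; apply/rowP=> i; rewrite !mxE.
  by case: (J i); rewrite ?mulr1 ?mulr0.
pose E := g *m D *m u.
have EE a b : E a b = \sum_(i | J i) g a i * u i b.
  rewrite !mxE [RHS]big_mkcond; apply: eq_bigr => i _.
  rewrite mul_mx_diag !mxE; case: (J i); rewrite ?mulr1 ?mulr0 ?mul0r //.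
have trE : \tr (E *m E^t* ) = (\sum_(i | J i) s i ^+ 2)%:C.
  rewrite /E !trmx_mul !map_mxM DH !mulmxA -(mulmxA _ u) uu mulmx1.
  rewrite -(mulmxA g) DD -mulmxA mxtrace_mulC -mulmxA gg /D mulmx_diag.
  rewrite mxtrace_diag rmorph_sum [RHS]big_mkcond; apply: eq_bigr => i _.
  by rewrite !mxE; case: (J i); rewrite ?mul1r ?mul0r.
have {}trE : \sum_a \sum_b (complex.Re (E a b) ^+ 2 + complex.Im (E a b) ^+ 2) =
    \sum_(i | J i) s i ^+ 2.
  apply: (@complexI R); rewrite -trE rmorph_sum; apply: eq_bigr => a _.
  rewrite mxE rmorph_sum; apply: eq_bigr => b _.
  have -> : (E^t* ) b a = Num.conj (E a b) by rewrite 2!mxE.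
  by rewrite mulrC sqr_norm_conj.
rewrite -trE; apply: ler_sum => a _; apply: ler_sum => b _.
by rewrite -EE lerDl sqr_ge0.
Qed.
End Truncation.

(** * Approximation by cut multipliers *)

Section Approximation.

Lemma truncated_svd (R : realType) m n (A : 'M[R]_(m, n)) (tau : R) :
  (0 < m)%N -> (0 < n)%N -> 0 < tau -> (forall a b, `|A a b| <= 1) ->
  exists W : 'M[R]_(m, n),
    cut_multiplier (2 * Num.sqrt (m * n)%:R * nucnorm A / tau ^+ 2) W /\
    \sum_a \sum_b (A a b - W a b) ^+ 2 <= tau * nucnorm A.
Proof.
move=> m0 n0 tau0 A1.
have [s [g [u [[s_ge0 ->] AE uu gg]]]] := complex_svd A.
have gle := complex_svd_entry_le A1 AE uu.
have ule := complex_svd_vector_le A1 AE gg.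
pose big i := tau <= s i.
exists (\sum_(i | big i) \matrix_(a, b) complex.Re (g a i * u i b)); split.
  (* For [s i >= tau], [1 / s i <= s i / tau ^+ 2], which turns the sum of the weights into a
     multiple of the nuclear norm. *)
  apply: (@cut_multiplier_le _ _ _
    (\sum_(i | big i) 2 * Num.sqrt (m * n)%:R / s i)).
    rewrite mulr_sumr mulr_suml [leRHS](bigID big) /= ler_wpDr //.
      apply: sumr_ge0 => i _.
      by rewrite divr_ge0 ?sqr_ge0 // !mulr_ge0 ?sqrtr_ge0.
    apply: ler_sum => i bi; have si0 := lt_le_trans tau0 bi.
    rewrite -[leRHS]mulrA ler_wpM2l ?mulr_ge0 ?sqrtr_ge0 //.
    rewrite ler_pdivlMr ?exprn_gt0 // mulrC ler_pdivrMr // -expr2.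
    by rewrite ler_sqr // nnegrE ltW.
  apply: cut_multiplier_sum => i bi; have si0 := lt_le_trans tau0 bi.
  have sn0 : 0 < Num.sqrt n%:R :> R by rewrite sqrtr_gt0 ltr0n.
  have sm0 : 0 < Num.sqrt m%:R / s i by rewrite divr_gt0 // sqrtr_gt0 ltr0n.
  (* The factor 2 counts the two real rank one matrices in the real part of [g a i * u i b]. *)
  have -> : 2 * Num.sqrt (m * n)%:R / s i =
      Num.sqrt n%:R * (Num.sqrt m%:R / s i) + Num.sqrt n%:R * (Num.sqrt m%:R / s i).
    by rewrite natrM sqrtrM ?ler0n //; ring.
  have -> : \matrix_(a, b) complex.Re (g a i * u i b) =
      \matrix_(a, b) (complex.Re (g a i) * complex.Re (u i b)) -
      \matrix_(a, b) (complex.Im (g a i) * complex.Im (u i b)).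
    apply/matrixP=> a b; rewrite !mxE.
    by case: (g a i) => x y; case: (u i b).
  apply: cut_multiplierD; last apply: cut_multiplierN.
    by apply: cut_multiplier_rank1 => // [a|b]; [case: (gle a i)|case: (ule i b si0)].
  by apply: cut_multiplier_rank1 => // [a|b]; [case: (gle a i)|case: (ule i b si0)].
(* Since [A] is real, it is the real part of the full sum, so the error is the real part of the
   small terms; there [s i ^+ 2 <= tau * s i]. *)
have -> : \sum_a \sum_b (A a b - (\sum_(i | big i)
      \matrix_(a, b) complex.Re (g a i * u i b)) a b) ^+ 2 =
    \sum_a \sum_b complex.Re (\sum_(i | ~~ big i) g a i * u i b) ^+ 2.
  apply: eq_bigr => a _; apply: eq_bigr => b _; congr (_ ^+ 2).
  have -> : A a b = complex.Re ((map_mx (real_complex R) A) a b) by rewrite mxE.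
  rewrite AE mxE !complex_Re_sum (bigID big) /= summxE.
  under [X in _ - X]eq_bigr => i _ do rewrite mxE.
  by rewrite addrAC subrr add0r.
apply: le_trans (complex_svd_tail (fun i => ~~ big i) uu gg) _.
rewrite mulr_sumr [leRHS](bigID big) /= ler_wpDl //.
  by apply: sumr_ge0 => i _; rewrite mulr_ge0 // ltW.
apply: ler_sum => i; rewrite /big -ltNge => /ltW si.
by rewrite expr2 ler_wpM2r.
Qed.

(** The threshold [tau = e * sqrt (m * n)] makes both bounds independent of the dimensions. *)
Lemma low_nucnorm_approx (R : realType) m n (A : 'M[R]_(m, n)) (q e : R) :
  (0 < m)%N -> (0 < n)%N -> 0 < e -> maxnorm A <= 1 ->
  nucnorm A <= q * Num.sqrt (m * n)%:R ->
  exists W : 'M[R]_(m, n),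
    cut_multiplier (2 * q / e ^+ 2) W /\ nfrob (A - W) <= Num.sqrt (e * q).
Proof.
move=> m0 n0 e0 A1 nA.
have mn0 : 0 < (m * n)%:R :> R by rewrite ltr0n muln_gt0 m0.
set r := Num.sqrt (m * n)%:R in nA *.
have r0 : 0 < r by rewrite sqrtr_gt0.
have rr : r ^+ 2 = (m * n)%:R by rewrite sqr_sqrtr // ltW.
have Aab a b : `|A a b| <= 1.
  apply: le_trans A1; rewrite /maxnorm (bigD1 a) //= le_max; apply/orP; left.
  by rewrite (bigD1 b) //= le_max lexx.
have [W [hW dW]] := truncated_svd m0 n0 (mulr_gt0 e0 r0) Aab.
exists W; split.
  apply: cut_multiplier_le hW; rewrite -/r.
  have -> : 2 * q / e ^+ 2 = 2 * r * (q * r) / (e * r) ^+ 2.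
    by field; rewrite !gt_eqF.
  rewrite ler_pM2r ?invr_gt0 ?exprn_gt0 ?mulr_gt0 // ler_pM2l //.
  by rewrite mulr_gt0.
rewrite /nfrob ler_wsqrtr // ler_pdivrMl // -rr.
under eq_bigr => a _ do under eq_bigr => b _ do rewrite !mxE.
apply: le_trans dW _; rewrite -mulrA (_ : r ^+ 2 * (e * q) = e * (r * (q * r))).
  by rewrite !ler_pM2l.
by ring.
Qed.
End Approximation.

(** * The normalized Frobenius norm *)

Section Frobenius.
Variables (R : realType) (m n : nat).
Implicit Types A B : 'M[R]_(m, n).

Lemma nfrob_le A B : (forall a b, `|A a b| <= `|B a b|) -> nfrob A <= nfrob B.
Proof.
move=> AB; rewrite /nfrob ler_wsqrtr // ler_wpM2l ?invr_ge0 ?ler0n //.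
apply: ler_sum => a _; apply: ler_sum => b _.
by rewrite -real_normK ?num_real // -[leRHS]real_normK ?num_real // ler_sqr ?nnegrE.
Qed.

Lemma nfrobN A : nfrob (- A) = nfrob A.
Proof. by apply/le_anti/andP; split; apply: nfrob_le => a b; rewrite mxE normrN. Qed.

(** Minkowski's inequality from the entrywise bound [(x + y)^2 <= (1 + b/a) x^2 + (1 + a/b) y^2],
    with [a] and [b] close to the two norms. *)
Lemma nfrobD A B : nfrob (A + B) <= nfrob A + nfrob B.
Proof.
pose S (M : 'M[R]_(m, n)) := (m * n)%:R^-1 * \sum_a \sum_b M a b ^+ 2.
have S_ge0 M : 0 <= S M.
  rewrite mulr_ge0 ?invr_ge0 ?ler0n //.
  by apply: sumr_ge0 => a _; apply: sumr_ge0 => b _; rewrite sqr_ge0.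
have SD a b : 0 < a -> 0 < b -> S A <= a ^+ 2 -> S B <= b ^+ 2 ->
    S (A + B) <= (a + b) ^+ 2.
  move=> a0 b0 hA hB.
  have : S (A + B) <= (1 + b / a) * S A + (1 + a / b) * S B.
    rewrite /S !(mulrCA _ _^-1) -mulrDr.
    rewrite ler_wpM2l ?invr_ge0 ?ler0n // !mulr_sumr -big_split.
    apply: ler_sum => i _; rewrite !mulr_sumr -big_split.
    apply: ler_sum => j _; rewrite mxE /= -subr_ge0.
    set x := A i j; set y := B i j.
    have -> : (1 + b / a) * x ^+ 2 + (1 + a / b) * y ^+ 2 - (x + y) ^+ 2 =
        (b / a) * (x - a / b * y) ^+ 2 by field; rewrite !gt_eqF.
    by rewrite mulr_ge0 ?sqr_ge0 // divr_ge0 ?ltW.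
  move=> /le_trans; apply.
  have -> : (a + b) ^+ 2 = (1 + b / a) * a ^+ 2 + (1 + a / b) * b ^+ 2.
    by field; rewrite !gt_eqF.
  by apply: lerD; rewrite ler_wpM2l // addr_ge0 // divr_ge0 ?ltW.
(* The weights [a] and [b] must be positive while the norms may vanish, so [e / 2] is added to
   each. *)
suff add_eps (e : R) : 0 < e -> nfrob (A + B) <= nfrob A + nfrob B + e.
  exact/ler_addgt0Pr.
move=> e0.
have e2 : 0 < e / 2 by rewrite divr_gt0.
have lt0 M : 0 < nfrob M + e / 2 by rewrite ltr_wpDl ?sqrtr_ge0.
have leS M : S M <= (nfrob M + e / 2) ^+ 2.
  rewrite -(sqr_sqrtr (S_ge0 M)) ler_sqr ?nnegrE ?sqrtr_ge0 //.
    by rewrite lerDl ltW.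
  exact: ltW.
rewrite [e]splitr addrACA.
rewrite -[leRHS]ger0_norm; last by rewrite addr_ge0 // ltW.
by rewrite -sqrtr_sqr ler_wsqrtr //; apply: SD.
Qed.
End Frobenius.

(** * Comparison of the masks [P] and [Q] *)

Section Masking.
Variables (R : realType) (m n : nat).
Hypotheses (m_gt0 : (0 < m)%N) (n_gt0 : (0 < n)%N).

Lemma cut_bound_cutnorm (D : 'M[R]_(m, n)) :
  cut_bound D ((m * n)%:R * cutnorm D).
Proof.
have mn0 : 0 < (m * n)%:R :> R by rewrite ltr0n muln_gt0 m_gt0.
move=> x y hx hy.
rewrite /cutnorm mulrA divff ?gt_eqF // mul1r.
have formE (v : 'cV[R]_m) (w : 'cV[R]_n) :
    (v^T *m D *m w) 0 0 = \sum_a \sum_b v a 0 * D a b * w b 0.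
  rewrite !mxE exchange_big; apply: eq_bigr => b _.
  by rewrite !mxE mulr_suml; apply: eq_bigr => a _; rewrite !mxE.
apply: ub_le_sup; last first.
  exists (\col_a x a); first by move=> a; rewrite mxE.
  exists (\col_b y b); first by move=> b; rewrite mxE.
  rewrite formE; congr `|_|; apply: eq_bigr => a _; apply: eq_bigr => b _.
  by rewrite !mxE.
(* The supremum is an upper bound only once the set is known to be bounded; the entrywise l1 norm
   bounds it. *)
exists (\sum_a \sum_b `|D a b|) => _ [v hv [w hw <-]].
rewrite formE (le_trans (ler_norm_sum _ _ _)) //; apply: ler_sum => a _.
rewrite (le_trans (ler_norm_sum _ _ _)) //; apply: ler_sum => b _.
rewrite !normrM -[leRHS]mulr1 ler_pM ?mulr_ge0 //.
by rewrite ler_piMl.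
Qed.

Lemma cutnorm_ge0 (D : 'M[R]_(m, n)) : 0 <= cutnorm D.
Proof.
have mn0 : 0 < (m * n)%:R :> R by rewrite ltr0n muln_gt0 m_gt0.
by have := cut_bound_ge0 (cut_bound_cutnorm D); rewrite pmulr_rge0.
Qed.

(* Since [P] is binary and [Q] has entries in [[0, 1]], [Q^2 - P^2 <= Q - P]
   entrywise, so only a bound linear in [Q - P] is needed. *)
Lemma nfrob_mask_cut_multiplier (K : R) (W P Q : 'M[R]_(m, n)) :
  0 <= K -> cut_multiplier K W -> binary_mx P -> (forall i j, 0 <= Q i j <= 1) ->
  nfrob (hadamard W Q) <=
    nfrob (hadamard W P) + K * Num.sqrt (cutnorm (P - Q)).
Proof.
move=> K0 hW hP hQ.
have mn0 : 0 < (m * n)%:R :> R by rewrite ltr0n muln_gt0 m_gt0.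
set d := cutnorm _; have d0 : 0 <= d := cutnorm_ge0 _.
have hWD := cut_multiplier_sqr hW (cut_bound_cutnorm (P - Q)).
pose S (M : 'M[R]_(m, n)) := (m * n)%:R^-1 * \sum_a \sum_b M a b ^+ 2.
have S_ge0 M : 0 <= S M.
  rewrite mulr_ge0 ?invr_ge0 ?ler0n //.
  by apply: sumr_ge0 => a _; apply: sumr_ge0 => b _; rewrite sqr_ge0.
have SS : S (hadamard W Q) <= S (hadamard W P) + K ^+ 2 * d.
  rewrite /S ler_pdivrMl // mulrDr mulVKf ?gt_eqF //.
  have {hWD} : - \sum_a \sum_b W a b ^+ 2 * (P - Q) a b <= (m * n)%:R * (K ^+ 2 * d).
    by rewrite mulrCA; apply: le_trans hWD; rewrite -normrN ler_norm.
  rewrite -(lerD2l (\sum_a \sum_b hadamard W P a b ^+ 2)).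
  apply: le_trans; rewrite -sumrB; apply: ler_sum => a _.
  rewrite -sumrB; apply: ler_sum => b _; rewrite !mxE.
  have -> : (W a b * P a b) ^+ 2 - W a b ^+ 2 * (P a b - Q a b) = W a b ^+ 2 * Q a b.
    by case: (hP a b) => ->; ring.
  have /andP[Q0 Q1] := hQ a b.
  by rewrite exprMn ler_wpM2l ?sqr_ge0 // expr2 ler_piMr.
have b0 : 0 <= nfrob (hadamard W P) + K * Num.sqrt d.
  by rewrite addr_ge0 ?sqrtr_ge0 // mulr_ge0 ?sqrtr_ge0.
rewrite -[leRHS]ger0_norm // -sqrtr_sqr ler_wsqrtr // (le_trans SS) //.
have WP : nfrob (hadamard W P) ^+ 2 = S (hadamard W P).
  exact: sqr_sqrtr (S_ge0 _).
rewrite sqrrD WP (exprMn _ K) (sqr_sqrtr d0) lerD2r lerDl.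
by rewrite mulrn_wge0 // !mulr_ge0 ?sqrtr_ge0.
Qed.

Lemma nucnorm_ge0 (A : 'M[R]_(m, n)) : 0 <= nucnorm A.
Proof. by have [s [g [u [[s0 ->] _ _ _]]]] := complex_svd A; apply: sumr_ge0. Qed.

Lemma nfrob_hadamard_le (A B : 'M[R]_(m, n)) :
  (forall i j, 0 <= B i j <= 1) -> nfrob (hadamard A B) <= nfrob A.
Proof.
move=> hB; apply: nfrob_le => a b; rewrite mxE normrM ler_piMr //.
by have /andP[B0 B1] := hB a b; rewrite ger0_norm.
Qed.

(** [X - Y] is exchanged for its approximation [W] once under each mask. Masks are contractions, so
    each exchange costs [2 * sqrt (e * q)]; the multiplier constants of the two approximations add
    up to [4 * q / e ^+ 2]. *)
Lemma nfrob_mask_nucnorm (X Y P Q : 'M[R]_(m, n)) (q e : R) :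
  0 < e -> 0 <= q -> maxnorm X <= 1 -> maxnorm Y <= 1 ->
  nucnorm X <= q * Num.sqrt (m * n)%:R ->
  nucnorm Y <= q * Num.sqrt (m * n)%:R ->
  binary_mx P -> (forall i j, 0 <= Q i j <= 1) ->
  nfrob (hadamard (X - Y) Q) <= nfrob (hadamard (X - Y) P) +
    (4 * Num.sqrt (e * q) + 4 * q / e ^+ 2 * Num.sqrt (cutnorm (P - Q))).
Proof.
move=> e0 q0 X1 Y1 nX nY hP hQ.
have [W1 [hW1 dW1]] := low_nucnorm_approx m_gt0 n_gt0 e0 X1 nX.
have [W2 [hW2 dW2]] := low_nucnorm_approx m_gt0 n_gt0 e0 Y1 nY.
set Z := X - Y; pose W := W1 - W2.
have hW : cut_multiplier (4 * q / e ^+ 2) W.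
  have -> : 4 * q / e ^+ 2 = 2 * q / e ^+ 2 + 2 * q / e ^+ 2 by ring.
  by apply: cut_multiplierD => //; apply: cut_multiplierN.
have dW : nfrob (Z - W) <= 2 * Num.sqrt (e * q).
  have -> : Z - W = (X - W1) - (Y - W2).
    by apply/matrixP=> a b; rewrite !mxE; ring.
  rewrite (le_trans (nfrobD _ _)) // nfrobN mulr_natl mulr2n.
  exact: lerD.
have K0 : 0 <= 4 * q / e ^+ 2 by rewrite divr_ge0 ?sqr_ge0 // mulr_ge0.
have hWPQ := nfrob_mask_cut_multiplier K0 hW hP hQ.
have hPb i j : 0 <= P i j <= 1 by case: (hP i j) => ->; rewrite ?lexx ler01.
have hZQ : nfrob (hadamard Z Q) <= nfrob (hadamard W Q) + 2 * Num.sqrt (e * q).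
  have -> : hadamard Z Q = hadamard W Q + hadamard (Z - W) Q.
    by apply/matrixP=> a b; rewrite !mxE; ring.
  rewrite (le_trans (nfrobD _ _)) // lerD2l.
  exact: le_trans (nfrob_hadamard_le _ hQ) dW.
have hZP : nfrob (hadamard W P) <= nfrob (hadamard Z P) + 2 * Num.sqrt (e * q).
  have -> : hadamard W P = hadamard Z P + - hadamard (Z - W) P.
    by apply/matrixP=> a b; rewrite !mxE; ring.
  rewrite (le_trans (nfrobD _ _)) // lerD2l nfrobN.
  exact: le_trans (nfrob_hadamard_le _ hPb) dW.
lra.
Qed.
End Masking.

(** * Choice of the threshold and the final estimate *)

Lemma expR_half_sqrt (R : realType) (x : R) : Num.sqrt (expR x) = expR (x / 2).
Proof.
by rewrite {1}[x](splitr x) expRD -expr2 sqrtr_sqr ger0_norm ?expR_ge0.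
Qed.

(** With [L = - ln d], this weakens a power [d^(1/k)] to the logarithmic scale:
    [expR (L / k) >= L / k >= sqrt L / k]. *)
Lemma expRN_le_inv_sqrt (R : realType) (k L : R) : 0 < k -> 1 <= L ->
  expR (- L / k) <= k / Num.sqrt L.
Proof.
move=> k0 L1; have L0 : 0 < L := lt_le_trans ltr01 L1.
have sL0 : 0 < Num.sqrt L by rewrite sqrtr_gt0.
have sL : Num.sqrt L <= L.
  rewrite -{2}(sqr_sqrtr (ltW L0)) expr2 ler_peMl ?(ltW sL0) //.
  by rewrite -sqrtr1 ler_wsqrtr.
rewrite mulNr expRN -[k / _]invf_div lef_pV2 ?posrE ?expR_gt0 ?divr_gt0 //.
apply: le_trans (expR_ge1Dx _).
rewrite (le_trans (_ : _ <= L / k)) ?ler_pM2r ?invr_gt0 //.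
by rewrite lerDr.
Qed.

Theorem theorem7p4 (R : realType) (q : R) :
  exists C : R, forall (m n : nat) (X Y P Q : 'M[R]_(m, n)),
    maxnorm X <= 1 -> maxnorm Y <= 1 ->
    nucnorm X <= q * Num.sqrt (m * n)%:R ->
    nucnorm Y <= q * Num.sqrt (m * n)%:R ->
    binary_mx P ->
    (forall i j, 0 <= Q i j <= 1) ->
    cutnorm (P - Q) <= expR (- expR 1) ->
    nfrob (hadamard (X - Y) Q) <=
      nfrob (hadamard (X - Y) P) + C * err_term (cutnorm (P - Q)).
Proof.
(* Here 64 = 4 * 16 and 16 = 4 * 4: the coefficients 4 of [nfrob_mask_nucnorm] times the values
   [k = 16] and [k = 4] in [expRN_le_inv_sqrt]. *)
exists (64 * Num.sqrt q + 16 * q) => m n X Y P Q X1 Y1 nX nY hP hQ.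
(* For an empty matrix, [0^-1 = 0] makes both Frobenius norms and the cut norm vanish. *)
case: (posnP (m * n)) => [mn0 _|].
  by rewrite /nfrob /cutnorm /err_term mn0 invr0 !mul0r eqxx mulr0 addr0.
rewrite muln_gt0 => /andP[m0 n0].
have q0 : 0 <= q.
  have := le_trans (nucnorm_ge0 X) nX.
  by rewrite pmulr_lge0 // sqrtr_gt0 ltr0n muln_gt0 m0.
have main e (e0 : 0 < e) := nfrob_mask_nucnorm m0 n0 e0 q0 X1 Y1 nX nY hP hQ.
have := cutnorm_ge0 m0 n0 (P - Q).
set d := cutnorm (P - Q) in main *; rewrite /err_term => d_ge0.
(* At cut norm 0 the error term is 0, but [e] can then be arbitrarily small at no cost. *)
case: eqVneq => [dz _|dN0 dle].
  rewrite mulr0 addr0.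
  suff add_eps (h : R) : 0 < h -> nfrob (hadamard (X - Y) Q) <=
      nfrob (hadamard (X - Y) P) + h by exact/ler_addgt0Pr.
  move=> h0.
  have q1 : 0 < q + 1 by rewrite ltr_wpDl.
  have h4 : 0 < h / 4 by rewrite divr_gt0.
  (* Chosen so that [e * q <= (h / 4) ^+ 2]; the denominator [q + 1] stays positive when [q = 0]. *)
  pose e := (h / 4) ^+ 2 / (q + 1).
  have e0 : 0 < e by rewrite divr_gt0 ?exprn_gt0.
  apply: le_trans (main e e0) _; rewrite dz sqrtr0 mulr0 addr0 lerD2l.
  have : Num.sqrt (e * q) <= h / 4.
    rewrite -[leRHS]ger0_norm ?(ltW h4) // -sqrtr_sqr ler_wsqrtr //.
    by rewrite /e mulrAC ler_pdivrMr // ler_wpM2l ?sqr_ge0 // lerDl.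
  lra.
have d0 : 0 < d by rewrite lt_neqAle eq_sym dN0.
set L := - ln d; have dE : d = expR (- L) by rewrite opprK lnK.
(* The smallness of the cut norm enters here: it gives [ln L >= 1], so the error term is at least
   [1 / sqrt L]. *)
have Le : expR 1 <= L.
  by move: dle; rewrite dE ler_expR lerN2.
have L1 : 1 <= L by apply: le_trans Le; apply: le_trans (expR_ge1Dx 1); rewrite lerDl.
have L0 : 0 < L := lt_le_trans ltr01 L1.
have sL0 : 0 < Num.sqrt L by rewrite sqrtr_gt0.
have lnL : 1 <= ln L by rewrite -[leLHS]expRK ler_ln ?posrE ?expR_gt0.
have errge : (Num.sqrt L)^-1 <= Num.sqrt (ln L / L).
  rewrite -sqrtrV ?(ltW L0) // ler_wsqrtr // -[leLHS]mul1r.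
  by rewrite ler_pM2r ?invr_gt0.
(* This is [d^(1/8)], so [sqrt e = d^(1/16)] and [sqrt d / e ^+ 2 = d^(1/4)]. *)
pose e := expR (- L / 8).
apply: le_trans (main e (expR_gt0 _)) _; rewrite lerD2l.
apply: (@le_trans _ _ ((64 * Num.sqrt q + 16 * q) * (Num.sqrt L)^-1)); last first.
  by rewrite ler_wpM2l // addr_ge0 // mulr_ge0 ?sqrtr_ge0.
have -> : Num.sqrt (e * q) = expR (- L / 16) * Num.sqrt q.
  rewrite sqrtrM ?expR_ge0 // expR_half_sqrt; congr (expR _ * _); by field.
have -> : 4 * q / e ^+ 2 * Num.sqrt d = 4 * q * expR (- L / 4).
  rewrite -mulrA dE expR_half_sqrt /e expr2 -expRD -expRN -expRD.
  by congr (_ * expR _); field.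
have h16 : expR (- L / 16) <= 16 / Num.sqrt L by apply: expRN_le_inv_sqrt.
have h4 : expR (- L / 4) <= 4 / Num.sqrt L by apply: expRN_le_inv_sqrt.
have k1 := ler_wpM2r (sqrtr_ge0 q) h16.
have k2 := ler_wpM2l q0 h4.
nra.
Qed.
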